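(* Let $\beta\in(0,1/2]$ and $\alpha\in(0,1)$, write $\bar\beta=1-\beta$, and let $W$ be the root runoff on the critical Bienaymé–Galton–Watson tree with parameter $\beta$ and point contributions of parameter $\alpha$ (as defined in the context). Put $$\alpha_c(\beta)=\tfrac12\left(1+\beta\bar\beta-\sqrt{\beta\bar\beta(2+\beta\bar\beta)}\right).$$ Then for $\alpha\le\alpha_c(\beta)$, $$\mathbb{E}W=\frac{1}{2\beta(1-\beta)}\left(1-2\alpha-\sqrt{1-4\alpha(1-\alpha+\beta(1-\beta))}\right),$$ while for $\alpha>\alpha_c(\beta)$, $\mathbb{E}W=\infty$.
   Context: Runoff model. Consider a Bienaymé–Galton–Watson tree with root $0$ in which nodes have i.i.d. offspring numbers $Z$ with $\mathbb{P}(Z=0)=\mathbb{P}(Z=2)=\beta\bar\beta$ and $\mathbb{P}(Z=1)=\beta^2+\bar\beta^2$, where $\bar\beta=1-\beta$. (The offspring distribution has mean $1$, so the tree is almost surely finite.) Independently of the tree, attach to the nodes i.i.d. random variables $X_i$ with $\mathbb{P}(X_i=1)=\alpha$ and $\mathbb{P}(X_i=-1)=1-\alpha$. Define the runoff $W_i$ from node $i$ recursively, from the leaves towards the root, by $$W_i=\max\Big(X_i+\sum_{j:\,j\to i}W_j,\;0\Big),$$ where $j\to i$ means that $j$ is a child of $i$ (so $W_i=\max(X_i,0)$ at a leaf). Let $W=W_0$ be the runoff at the root. Equivalently, the law of $W$ satisfies $W\overset{d}{=}\max(W_LI_L+W_RI_R+X,0)$, where $W_L,W_R$ are distributed as $W$,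 $I_L\sim\mathrm{Bernoulli}(1-\beta)$, $I_R\sim\mathrm{Bernoulli}(\beta)$, $X$ is distributed as the $X_i$, and $W_L,W_R,I_L,I_R,X$ are independent. *)

(* Defs.v *)
From HB Require Import structures.
From mathcomp Require Import all_boot all_order all_algebra finmap.
From mathcomp Require Import all_classical all_reals all_analysis.

Set Implicit Arguments.
Unset Strict Implicit.
Unset Printing Implicit Defensive.

Import Order.TTheory GRing.Theory Num.Theory.

Local Open Scope classical_set_scope.
Local Open Scope ring_scope.

(* Nodes carry Ulam-Harris labels: the root is [::] and the children of u are
   rcons u k for k < z u, where z u is the offspring number of u.  Labels
   outside the tree also carry a number z u, which plays no role. *)
Definition family_tree (z : seq nat -> nat) : set (seq nat) :=
  [set u | forall v k, prefix (rcons v k) u -> (k < z v)%N].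

Section deterministic_runoff.
Context {R : realType}.
Implicit Types (z : seq nat -> nat) (x : seq nat -> R) (u : seq nat).

(* "runoff_at z x u w" states that the recursion, run from the leaves up, gives
   node u the runoff w.  As the predicate is inductive, u has such a w exactly
   when the subtree rooted at u has no infinite line of descent. *)
Inductive runoff_at z x : seq nat -> R -> Prop :=
| RunoffNode u (w : nat -> R) :
    (forall k, (k < z u)%N -> runoff_at z x (rcons u k) (w k)) ->
    runoff_at z x u (Num.max (x u + \sum_(k < z u) w k) 0).

(* The value 0 is only used when the subtree rooted at u is infinite. *)
Definition runoff z x u : R := xget 0 [set w | runoff_at z x u w].

Lemma runoff_at_unique z x u w w' :
  runoff_at z x u w -> runoff_at z x u w' -> w = w'.
Proof.
move=> h; elim: h w' => {}u {}w _ IH w' h'.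
inversion h' as [u' w1 h1 eu ew]; subst u'.
by congr (Num.max (_ + _) 0); apply: eq_bigr => k _; apply: IH => //; exact: h1.
Qed.

Lemma runoff_at_runoff z x u w : runoff_at z x u w -> runoff z x u = w.
Proof.
move=> h; rewrite /runoff; case: xgetP => [w' _ h'|/(_ w)//].
exact: runoff_at_unique h' h.
Qed.

Lemma runoff_at_rec z x u :
  (forall k, (k < z u)%N -> exists w, runoff_at z x (rcons u k) w) ->
  runoff_at z x u
    (Num.max (x u + \sum_(k < z u) runoff z x (rcons u k)) 0).
Proof.
move=> h; apply: (RunoffNode (w := fun k => runoff z x (rcons u k))) => k kz.
by have [w hw] := h k kz; rewrite (runoff_at_runoff hw).
Qed.

Lemma family_tree_rcons z u k :
  family_tree z u -> (k < z u)%N -> family_tree z (rcons u k).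
Proof.
move=> tu kz v j /prefixP[s]; case/lastP: s => [|s i].
  by rewrite cats0 => /rcons_inj[<- <-].
by rewrite -rcons_cat => /rcons_inj[us _]; apply: tu; rewrite us prefix_prefix.
Qed.

Lemma runoffE z x u : finite_set (family_tree z) -> family_tree z u ->
  runoff z x u =
    Num.max (x u + \sum_(k < z u) runoff z x (rcons u k)) 0.
Proof.
move=> /finite_seqP[s ts].
have bnd v : family_tree z v -> (size v <= \max_(v' <- s) size v')%N.
  by rewrite ts /= => vs; exact: leq_bigmax_seq.
have ex n v : family_tree z v -> (\max_(v' <- s) size v' < n + size v)%N ->
    exists w, runoff_at z x v w.
  elim: n v => [|n IH] v tv; first by rewrite add0n ltnNge bnd.
  rewrite addSnnS => hv; eexists; apply: runoff_at_rec => k kz.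
  by apply: IH; [exact: family_tree_rcons | rewrite size_rcons].
move=> tu; apply/runoff_at_runoff/runoff_at_rec => k kz.
apply: (ex (\max_(v' <- s) size v').+1); first exact: family_tree_rcons.
by rewrite addSn ltnS leq_addr.
Qed.

End deterministic_runoff.

Section runoff_model.
Context {d : measure_display} {T : measurableType d} {R : realType}.
Variable P : probability T R.

Definition mutually_independent (I : choiceType) (F : I -> set_system T) :=
  forall (J : {fset I}) (A : I -> set T),
    (forall i, i \in J -> F i (A i)) ->
    P (\bigcap_(i in [set` J]) A i) = (\prod_(i <- J) P (A i))%E.

Definition sigma_rv {d'} {T' : measurableType d'} (Y : {RV P >-> T'}) :
  set_system T := preimage_set_system setT Y measurable.

(* inl u indexes the offspring number of u, inr u its point contribution:
   independence over the disjoint union says at once that each of the two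
   families is independent and that they are independent of each other. *)
Definition node_sigma (Z : seq nat -> {RV P >-> nat})
    (X : seq nat -> {RV P >-> R}) (i : seq nat + seq nat) : set_system T :=
  match i with
  | inl u => sigma_rv (Z u)
  | inr u => sigma_rv (X u)
  end.

Record runoff_model (beta alpha : R) (Z : seq nat -> {RV P >-> nat})
    (X : seq nat -> {RV P >-> R}) : Prop := RunoffModel {
  model_indep : mutually_independent (node_sigma Z X) ;
  offspring0 : forall u, P [set t | Z u t = 0%N] = (beta * (1 - beta))%:E ;
  offspring1 : forall u,
    P [set t | Z u t = 1%N] = (beta ^+ 2 + (1 - beta) ^+ 2)%:E ;
  offspring2 : forall u, P [set t | Z u t = 2%N] = (beta * (1 - beta))%:E ;
  contribution1 : forall u, P [set t | X u t = 1] = alpha%:E ;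
  contributionN1 : forall u, P [set t | X u t = - 1] = (1 - alpha)%:E
}.

Definition root_runoff (Z : seq nat -> {RV P >-> nat})
    (X : seq nat -> {RV P >-> R}) (t : T) : R :=
  runoff (fun u => Z u t) (fun u => X u t) [::].

End runoff_model.

Definition alpha_c {R : realType} (beta : R) : R :=
  2^-1 * (1 + beta * (1 - beta)
    - Num.sqrt (beta * (1 - beta) * (2 + beta * (1 - beta)))).

(* Main.v *)
Require Import Defs.
From HB Require Import structures.
From mathcomp Require Import all_boot all_order all_algebra finmap.
From mathcomp Require Import all_classical all_reals all_analysis.
From mathcomp Require Import measurable_realfun ring lra.

Set Implicit Arguments.
Unset Strict Implicit.
Unset Printing Implicit Defensive.

Import Order.TTheory GRing.Theory Num.Theory.
Import numFieldNormedType.Exports.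

Local Open Scope classical_set_scope.
Local Open Scope ring_scope.

(* Write c = beta (1 - beta) and al = alpha.  The family tree is almost surely
   one of countably many finite marked trees t, whose probability w(t) is a
   product over the nodes and on which the root runoff is a fixed integer W(t).
   Hence E W = sum_t w(t) W(t), and G(s) = sum_t w(t) s ^ W(t) satisfies
     s G = (al s^2 + 1 - al) Phi(G) - p (1 - s),
   where Phi(g) = g + c (1 - g)^2 and p = (1 - al) Phi(G(0)).

   This is a quadratic equation in u = 1 - G.  With d = 1 - s,
   A = al s^2 + 1 - al and q = 1 - al - al s its discriminant is
     D = d^2 q^2 - 4 A c d (al d - eps),   eps = p - (1 - 2 al),
   and D >= 0 near s = 1 forces eps >= 0.

   If al <= alpha_c, then D > 0 on [0, 1), so by continuity u stays on the branch
   of the quadratic on which it starts at s = 0, the lower one.  That branch lies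
   below d m, where m is the smaller root of c m^2 - (1 - 2 al) m + al = 0, hence
   E W <= m.  Conversely, if M = E W is finite, then u / d tends to M as s tends
   to 1, which forces eps = 0 and c M^2 - (1 - 2 al) M + al = 0: for
   al <= alpha_c this yields M = m, and for al > alpha_c the quadratic has no
   nonnegative root. *)

(** * Finite marked trees *)

(* A finite tree with at most two children per node, in which every node carries
   a mark: [true] for a contribution 1, [false] for -1. *)
Inductive btree :=
| Leaf of bool
| Unary of bool & btree
| Binary of bool & btree & btree.

(** As [0.-1 = 0], the predecessor realises the truncation of the runoff at 0. *)
Definition runoff_step (b : bool) (k : nat) : nat := if b then k.+1 else k.-1.

Fixpoint tree_runoff (t : btree) : nat :=
  match t with
  | Leaf b => runoff_step b 0
  | Unary b t => runoff_step b (tree_runoff t)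
  | Binary b t1 t2 => runoff_step b (tree_runoff t1 + tree_runoff t2)
  end.

Fixpoint nodes (u : seq nat) (t : btree) : seq (seq nat * bool * nat) :=
  match t with
  | Leaf b => [:: (u, b, 0)]
  | Unary b t => (u, b, 1) :: nodes (rcons u 0) t
  | Binary b t1 t2 =>
      (u, b, 2) :: nodes (rcons u 0) t1 ++ nodes (rcons u 1) t2
  end.

(** The trees with at most [n] generations, which exhaust all finite trees as [n] grows. *)
Fixpoint trees (n : nat) : seq btree :=
  if n is m.+1 then
    flatten [seq Leaf b :: [seq Unary b t | t <- trees m]
                 ++ [seq Binary b t1 t2 | t1 <- trees m, t2 <- trees m]
            | b <- [:: true; false]]
  else [::].

Lemma uniq_map_inj (S S' : eqType) (f : S -> S') (s : seq S) :
  uniq (map f s) -> {in s &, injective f}.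
Proof.
elim: s => [//|x s IH] /= /andP[/negP xs us] y z; rewrite !inE.
move=> /predU1P[->|ys] /predU1P[->|zs] // fyz.
- by case: xs; rewrite fyz map_f.
- by case: xs; rewrite -fyz map_f.
- exact: IH.
Qed.

Lemma nat_eqb_prod (R : comNzSemiRingType) (S : Type) (s : seq S) (f : pred S) :
  \prod_(e <- s) (f e)%:R = (all f s)%:R :> R.
Proof.
elim: s => [|x s IH]; first by rewrite big_nil.
by rewrite big_cons IH /= -natrM mulnb.
Qed.

Lemma in_nodes_arity u t e : e \in nodes u t -> (e.2 <= 2)%N.
Proof.
elim: t u => [b|b t IH|b t1 IH1 t2 IH2] u /=; rewrite ?inE.
- by move/eqP => ->.
- by case/orP => [/eqP ->//|]; exact: IH.
- by rewrite mem_cat => /or3P[/eqP ->//| |]; [exact: IH1|exact: IH2].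
Qed.

Lemma prefix_nodes u t v b k : (v, b, k) \in nodes u t -> prefix u v.
Proof.
elim: t u => [b0|b0 t IH|b0 t1 IH1 t2 IH2] u /=; rewrite ?inE.
- by move=> /eqP[-> _ _]; exact: prefix_refl.
- case/orP => [/eqP[-> _ _]|/IH]; first exact: prefix_refl.
  by apply: prefix_trans; exact: prefix_rcons.
- rewrite mem_cat; case/or3P => [/eqP[-> _ _]|/IH1|/IH2].
  + exact: prefix_refl.
  + by apply: prefix_trans; exact: prefix_rcons.
  + by apply: prefix_trans; exact: prefix_rcons.
Qed.

(** Labels below [rcons u 0] and [rcons u 1] differ in the entry after [u], and all of them are
    longer than [u]. *)
Lemma uniq_nodes u t : uniq [seq e.1.1 | e <- nodes u t].
Proof.
have notin v k s : v \notin [seq e.1.1 | e <- nodes (rcons v k) s].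
  apply/mapP => -[[[w b] j] /prefix_nodes + /= vw]; rewrite -vw.
  by move=> /size_prefix; rewrite size_rcons ltnn.
elim: t u => [//|b t IH|b t1 IH1 t2 IH2] u /=; first by rewrite notin IH.
rewrite map_cat mem_cat negb_or !notin cat_uniq IH1 IH2 /= andbT.
apply/hasPn => v /mapP[[[w b2] k2] /prefix_nodes w1 /= ->].
apply/mapP => -[[[w' b1] k1] /prefix_nodes + /= ww']; rewrite -ww'.
move: w1 => /prefixP[s ->] /prefixP[s'].
by rewrite !cat_rcons => /eqP; rewrite eqseq_cat// eqxx.
Qed.

(** * Weighted sums over trees of bounded height *)

Section tree_sums.
Context {R : numDomainType}.
Implicit Types (p : seq nat -> bool -> nat -> R) (a : btree -> R).

(* The weight of (v, b, k) is that of node v carrying the mark b and having k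
   children.  It is instantiated by the node law and, for a fixed outcome, by
   the 0/1 indicator of that configuration. *)
Definition tree_weight p u t : R := \prod_(e <- nodes u t) p e.1.1 e.1.2 e.2.

Definition tree_sum p u n a : R := \sum_(t <- trees n) tree_weight p u t * a t.

(** The weight is a product over nodes, so it splits into the factor of the root and the weights of
    its subtrees. *)
Lemma tree_sumS p u n a :
  tree_sum p u n.+1 a = \sum_(b <- [:: true; false])
    (p u b 0 * a (Leaf b) + p u b 1 * tree_sum p (rcons u 0) n (a \o Unary b)
     + p u b 2 * tree_sum p (rcons u 0) n (fun t1 =>
         tree_sum p (rcons u 1) n (fun t2 => a (Binary b t1 t2)))).
Proof.
rewrite /tree_sum big_flatten big_map; apply: eq_bigr => b _.
rewrite big_cons big_cat big_map big_allpairs_dep /= addrA; congr (_ + _ + _).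
- by rewrite /tree_weight /= big_seq1.
- rewrite mulr_sumr; apply: eq_bigr => t _.
  by rewrite /tree_weight /= big_cons /= mulrA.
- rewrite mulr_sumr; apply: eq_bigr => t1 _.
  rewrite !mulr_sumr; apply: eq_bigr => t2 _.
  by rewrite /tree_weight /= big_cons big_cat /= !mulrA.
Qed.

Lemma tree_sumD p u n a1 a2 :
  tree_sum p u n (fun t => a1 t + a2 t) = tree_sum p u n a1 + tree_sum p u n a2.
Proof. by rewrite -big_split /=; apply: eq_bigr => t _; rewrite mulrDr. Qed.

Lemma tree_sumZ p u n k a :
  tree_sum p u n (fun t => k * a t) = k * tree_sum p u n a.
Proof. by rewrite mulr_sumr; apply: eq_bigr => t _; rewrite mulrCA. Qed.

Lemma eq_tree_sum p u n a1 a2 :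
  a1 =1 a2 -> tree_sum p u n a1 = tree_sum p u n a2.
Proof. by move=> aa; apply: eq_bigr => t _; rewrite aa. Qed.

End tree_sums.

Section nonnegative_weights.
Context {R : numDomainType} (p : seq nat -> bool -> nat -> R).
Hypothesis p_ge0 : forall u b k, 0 <= p u b k.
Implicit Types a : btree -> R.

Lemma tree_weight_ge0 u t : 0 <= tree_weight p u t.
Proof. by apply: prodr_ge0. Qed.

Lemma ler_tree_sum u n a1 a2 : (forall t, a1 t <= a2 t) ->
  tree_sum p u n a1 <= tree_sum p u n a2.
Proof.
by move=> aa; apply: ler_sum => t _; rewrite ler_wpM2l// tree_weight_ge0.
Qed.

Lemma tree_sum_ge0 u n a : (forall t, 0 <= a t) -> 0 <= tree_sum p u n a.
Proof. by move=> a0; apply: sumr_ge0 => t _; rewrite mulr_ge0// tree_weight_ge0. Qed.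

Lemma tree_sum_leS u n a : (forall t, 0 <= a t) ->
  tree_sum p u n a <= tree_sum p u n.+1 a.
Proof.
elim: n u a => [|n IH] u a a0.
  by rewrite {1}/tree_sum big_nil tree_sum_ge0.
rewrite tree_sumS [leRHS]tree_sumS; apply: ler_sum => b _.
rewrite !lerD// ler_wpM2l// ?IH => // [t|]; first exact: a0.
apply: le_trans (IH _ _ _).
  by apply: ler_tree_sum => t1; apply: IH => t2; exact: a0.
by move=> t1; apply: tree_sum_ge0 => t2; exact: a0.
Qed.

(** Covers both instances of the weight: the node law has total mass 1, and a fixed outcome shows at
    most one configuration at each node. *)
Lemma tree_sum1_le1 u n :
  (forall v, \sum_(b <- [:: true; false]) (p v b 0 + p v b 1 + p v b 2) <= 1) ->
  tree_sum p u n (fun=> 1) <= 1.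
Proof.
move=> p1; elim: n u => [|n IH] u; first by rewrite /tree_sum big_nil.
rewrite tree_sumS; apply: le_trans (p1 u); apply: ler_sum => b _.
rewrite !lerD ?mulr1// ler_piMr// ?IH//.
apply: le_trans (IH (rcons u 0)); apply: ler_tree_sum => t; exact: IH.
Qed.

End nonnegative_weights.

Lemma tree_weight_cst (R : numDomainType) (q : bool -> nat -> R) u v t :
  tree_weight (fun=> q) u t = tree_weight (fun=> q) v t.
Proof.
elim: t u v => [b|b t IH|b t1 IH1 t2 IH2] u v; rewrite /tree_weight /=.
- by rewrite !big_seq1.
- by rewrite !big_cons; congr (_ * _); exact: IH.
- by rewrite !big_cons !big_cat; congr (_ * (_ * _)); [exact: IH1|exact: IH2].
Qed.

(** Ties the model to the trees: [runoff_step b k] is the maximum of [(-1) ^+ ~~ b + k] and 0, where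
    [(-1) ^+ ~~ b] is 1 for the mark [true] and -1 for [false]. *)
Lemma runoff_at_tree (R : realType) (z : seq nat -> nat) (x : seq nat -> R) u t :
  (forall e, e \in nodes u t -> z e.1.1 = e.2 /\ x e.1.1 = (-1) ^+ ~~ e.1.2) ->
  runoff_at z x u (tree_runoff t)%:R.
Proof.
have step (b : bool) k :
    Num.max ((-1) ^+ (~~ b) + k%:R) 0 = (runoff_step b k)%:R :> R.
  case: b; first by rewrite expr0 nat1r max_l.
  case: k => [|k]; first by rewrite /= expr1 addr0 max_r// lerN10.
  by rewrite /= expr1 -natr1 addrC addrK max_l.
elim: t u => [b|b t IH|b t1 IH1 t2 IH2] u h.
- have [/= zu xu] := h (u, b, 0) (mem_head _ _).
  have := @RunoffNode _ z x u (fun=> 0); rewrite zu big_ord0 xu.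
  by rewrite -[X in _ + X]/(0%:R) step; apply.
- have [/= zu xu] := h (u, b, 1) (mem_head _ _).
  have := @RunoffNode _ z x u (fun=> (tree_runoff t)%:R).
  rewrite zu big_ord1 xu step; apply => -[|//] _.
  by apply: IH => e et; apply: h; rewrite /= in_cons et orbT.
- have [/= zu xu] := h (u, b, 2) (mem_head _ _).
  have := @RunoffNode _ z x u
    (fun k => if k == 0 then (tree_runoff t1)%:R else (tree_runoff t2)%:R).
  rewrite zu big_ord_recl big_ord1 /= -natrD xu step; apply => -[|[|//]] _ /=.
    by apply: IH1 => e et; apply: h; rewrite /= in_cons mem_cat et orbT.
  by apply: IH2 => e et; apply: h; rewrite /= in_cons mem_cat et !orbT.
Qed.

(** * The generating function of the root runoff *)

Section generating_function.
Context {R : realType} (c al : R).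

(** For [k <= 2], the joint probability of mark [b] and [k] children: 1 - 2 c is beta^2 + (1 -
    beta)^2. *)
Definition node_law (b : bool) (k : nat) : R :=
  (if b then al else 1 - al) * (if k == 1%N then 1 - 2 * c else c).

Definition node_sum n (a : btree -> R) : R :=
  tree_sum (fun=> node_law) [::] n a.

(* As 0 ^+ 0 = 1, pgf n 0 is the weight of the trees with runoff 0. *)
Definition pgf n (s : R) : R := node_sum n (fun t => s ^+ tree_runoff t).

Definition mean_runoff n : R := node_sum n (fun t => (tree_runoff t)%:R).

(* Equal to c + (1 - 2 c) g + c g^2. *)
Definition offspring_pgf (g : R) : R := g + c * (1 - g) ^+ 2.

Lemma node_sumS n a : node_sum n.+1 a = \sum_(b <- [:: true; false])
    (if b then al else 1 - al) * (c * a (Leaf b)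
      + (1 - 2 * c) * node_sum n (a \o Unary b)
      + c * node_sum n (fun t1 => node_sum n (fun t2 => a (Binary b t1 t2)))).
Proof.
have shift u b : tree_sum (fun=> node_law) u n b = node_sum n b.
  by apply: eq_bigr => t _; rewrite (tree_weight_cst _ u [::]).
rewrite [LHS]tree_sumS; apply: eq_bigr => b _; rewrite !shift.
rewrite /node_law /= -!mulrA -!mulrDr; congr (_ * (_ + _ * _)).
by apply: eq_tree_sum => t; exact: shift.
Qed.

(** The factor [s] undoes the predecessor, s s^(j-1) = s^j, except at j = 0, where it leaves s = 1 -
    (1 - s). The powers of 0 single out that case; [k] is the runoff of a possible sibling
    subtree. *)
Lemma node_sum_expr_step n (b : bool) s k :
  s * node_sum n (fun t => s ^+ runoff_step b (k + tree_runoff t)) =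
  if b then s ^+ 2 * (s ^+ k * pgf n s)
  else s ^+ k * pgf n s - (1 - s) * (0 ^+ k * pgf n 0).
Proof.
rewrite -tree_sumZ /pgf /node_sum; case: b.
  rewrite -!tree_sumZ; apply: eq_tree_sum => t /=.
  by rewrite exprS exprD; ring.
rewrite -3!tree_sumZ -mulN1r -tree_sumZ -tree_sumD; apply: eq_tree_sum => t /=.
rewrite -!exprD; case: (k + _)%N => [|j] /=; first by rewrite !expr0; ring.
by rewrite -exprS [0 ^+ _]exprS; ring.
Qed.

(** Decomposition at the root; the last term corrects for a mark -1 that meets no inflow. *)
Lemma pgfS n s : s * pgf n.+1 s =
  (al * s ^+ 2 + (1 - al)) * offspring_pgf (pgf n s)
  - (1 - al) * offspring_pgf (pgf n 0) * (1 - s).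
Proof.
have unary b : s * node_sum n (fun t => s ^+ tree_runoff (Unary b t)) =
    if b then s ^+ 2 * pgf n s else pgf n s - (1 - s) * pgf n 0.
  by have := node_sum_expr_step n b s 0; rewrite !expr0 !mul1r.
have binary b : s * node_sum n (fun t1 => node_sum n (fun t2 =>
      s ^+ tree_runoff (Binary b t1 t2))) =
    if b then s ^+ 2 * pgf n s ^+ 2 else pgf n s ^+ 2 - (1 - s) * pgf n 0 ^+ 2.
  rewrite -tree_sumZ.
  transitivity (node_sum n (fun t =>
      if b then s ^+ 2 * pgf n s * s ^+ tree_runoff t
      else pgf n s * s ^+ tree_runoff t
           + - (1 - s) * pgf n 0 * 0 ^+ tree_runoff t)).
    apply: eq_tree_sum => t; rewrite node_sum_expr_step; case: (b); ring.
  have pgfZ k r : node_sum n (fun t => k * r ^+ tree_runoff t) = k * pgf n r.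
    exact: tree_sumZ.
  case: (b); first by rewrite pgfZ; ring.
  by rewrite [LHS]tree_sumD -!/(node_sum n _) !pgfZ; ring.
rewrite [pgf n.+1 s]node_sumS big_cons big_seq1 /= expr0 expr1.
rewrite mulrDr; move: (unary true) (unary false) (binary true) (binary false).
rewrite /= /offspring_pgf => u1 u0 b1 b0.
transitivity (al * (c * s ^+ 2 + (1 - 2 * c) * (s ^+ 2 * pgf n s)
     + c * (s ^+ 2 * pgf n s ^+ 2))
  + (1 - al) * (c * s + (1 - 2 * c) * (pgf n s - (1 - s) * pgf n 0)
     + c * (pgf n s ^+ 2 - (1 - s) * pgf n 0 ^+ 2))); last by ring.
rewrite -u1 -u0 -b1 -b0 /comp /=; ring.
Qed.
Hypotheses (c_gt0 : 0 < c) (c_le : c <= 4^-1) (al_gt0 : 0 < al) (al_lt1 : al < 1).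

Let law_ge0 (u : seq nat) b k : 0 <= node_law b k.
Proof.
rewrite /node_law mulr_ge0//; first by case: b; rewrite ?subr_ge0 ltW.
by case: eqP => _; move: c_gt0 c_le; lra.
Qed.

Let node_sum_leS n a : (forall t, 0 <= a t) -> node_sum n a <= node_sum n.+1 a.
Proof. exact: (tree_sum_leS (p := fun=> node_law)). Qed.

Let ler_node_sum n a1 a2 : (forall t, a1 t <= a2 t) ->
  node_sum n a1 <= node_sum n a2.
Proof. exact: (ler_tree_sum (p := fun=> node_law)). Qed.

Lemma node_sum1_le1 n : node_sum n (fun=> 1) <= 1.
Proof.
apply: (tree_sum1_le1 (p := fun=> node_law)) => // _.
by rewrite big_cons big_seq1 /node_law /=; lra.
Qed.

Lemma pgf1 n : pgf n 1 = node_sum n (fun=> 1).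
Proof. by apply: eq_tree_sum => t; rewrite expr1n. Qed.

Lemma pgf_ge0 n s : 0 <= s -> 0 <= pgf n s.
Proof.
move=> s0; apply: (tree_sum_ge0 (p := fun=> node_law)) => // t.
exact: exprn_ge0.
Qed.

Lemma pgf_le1 n s : 0 <= s <= 1 -> pgf n s <= 1.
Proof.
move=> /andP[s0 s1]; apply: le_trans (node_sum1_le1 n).
by apply: ler_node_sum => t; exact: exprn_ile1.
Qed.

(** * The limit over all finite trees *)

Definition pgf_lim s : R := limn (pgf ^~ s).

Lemma cvg_pgf s : 0 <= s <= 1 -> pgf n s @[n --> \oo] --> pgf_lim s.
Proof.
move=> s01; have /andP[s0 _] := s01; apply: nondecreasing_is_cvgn.
  by apply/nondecreasing_seqP => n; apply: node_sum_leS => t; exact: exprn_ge0.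
by exists 1 => _ [n _ <-]; exact: pgf_le1.
Qed.

Lemma pgf_lim_ge0 s : 0 <= s <= 1 -> 0 <= pgf_lim s.
Proof.
move=> s01; have /andP[s0 _] := s01; apply: limr_ge; first exact: cvg_pgf.
by apply: nearW => n; exact: pgf_ge0.
Qed.

Lemma pgf_lim_le1 s : 0 <= s <= 1 -> pgf_lim s <= 1.
Proof.
move=> s01; apply: limr_le; first exact: cvg_pgf.
by apply: nearW => n; exact: pgf_le1.
Qed.

Lemma pgf_limE s : 0 <= s <= 1 -> s * pgf_lim s =
  (al * s ^+ 2 + (1 - al)) * offspring_pgf (pgf_lim s)
  - (1 - al) * offspring_pgf (pgf_lim 0) * (1 - s).
Proof.
move=> s01; have cs := cvg_pgf s01.
have c0 : pgf n 0 @[n --> \oo] --> pgf_lim 0 by apply: cvg_pgf; rewrite lexx ler01.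
have cS : s * pgf n.+1 s @[n --> \oo] --> s * pgf_lim s.
  by apply: cvgMr; move: cs; rewrite -cvg_shiftS.
have cPhi (f : nat -> R) l : f n @[n --> \oo] --> l ->
    offspring_pgf (f n) @[n --> \oo] --> offspring_pgf l.
  move=> fl; rewrite /offspring_pgf; apply: cvgD => //; apply: cvgMr.
  have fl1 : 1 - f n @[n --> \oo] --> 1 - l by apply: cvgB => //; exact: cvg_cst.
  by rewrite expr2; under eq_fun do rewrite expr2; exact: cvgM.
apply: (cvg_unique _ cS) => //; rewrite (eq_fun (fun n => pgfS n s)).
by apply: cvgB; [|apply: cvgMl]; apply: cvgMr; exact: cPhi.
Qed.

(** Almost sure finiteness of the critical tree: at s = 1 the functional equation reads G = G + c (1
    - G)^2. *)
Lemma pgf_lim1 : pgf_lim 1 = 1.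
Proof.
have := @pgf_limE 1; rewrite ler01 lexx => /(_ isT).
rewrite expr1n subrr mulr0 subr0 mulr1 addrC subrK !mul1r /offspring_pgf.
move=> /eqP; rewrite -subr_eq0 opprD addNKr oppr_eq0 mulf_eq0 (gt_eqF c_gt0) /=.
by rewrite expf_eq0 /= subr_eq0 => /eqP.
Qed.

(** The difference is a weighted sum of the nonnegative 1 - s^W(t), so it increases with [n] to its
    limit. *)
Lemma pgf_le_lim n s : 0 <= s <= 1 -> pgf n 1 - pgf n s <= 1 - pgf_lim s.
Proof.
move=> s01; have /andP[s0 s1] := s01.
have dE m : pgf m 1 - pgf m s = node_sum m (fun t => 1 - s ^+ tree_runoff t).
  rewrite pgf1 -mulN1r -tree_sumZ -[LHS]tree_sumD.
  by apply: eq_tree_sum => t; rewrite mulN1r.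
have cd : pgf m 1 - pgf m s @[m --> \oo] --> 1 - pgf_lim s.
  apply: cvgB; last exact: cvg_pgf.
  by rewrite -[X in _ --> X]pgf_lim1; apply: cvg_pgf; rewrite ler01 lexx.
rewrite -(cvg_lim _ cd)//.
apply: (@nondecreasing_cvgn_le R (fun m => pgf m 1 - pgf m s)).
  apply/nondecreasing_seqP => m; rewrite !dE; apply: node_sum_leS => t.
  by rewrite subr_ge0 exprn_ile1.
by apply: cvgP cd.
Qed.

(** Holds because s^k - r^k <= (s - r) (1 + s + ... + s^(k-1)), uniformly in [k]; it provides
    continuity on [0, 1). *)
Lemma pgf_lim_lipschitz r s : 0 <= r -> r <= s -> s < 1 ->
  0 <= pgf_lim s - pgf_lim r <= (s - r) / (1 - s).
Proof.
move=> r0 rs s1.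
have s01 : 0 <= s <= 1 by rewrite (le_trans r0 rs) ltW.
have r01 : 0 <= r <= 1 by rewrite r0 (le_trans rs)// ltW.
have step k : r ^+ k <= s ^+ k <= r ^+ k + (s - r) / (1 - s).
  rewrite lerXn2r ?nnegrE//=; last by rewrite (le_trans r0).
  have d0 : 0 < 1 - s by rewrite subr_gt0.
  elim: k => [|k IH].
    by rewrite !expr0 lerDl divr_ge0 ?subr_ge0// ltW.
  have rk1 : r ^+ k <= 1 by rewrite exprn_ile1//; case/andP: r01.
  have sdE : (s - r) / (1 - s) = (s - r) + s * ((s - r) / (1 - s)).
    by field; rewrite gt_eqF.
  rewrite sdE exprS [r ^+ _]exprS.
  have := ler_wpM2l (le_trans r0 rs) IH.
  have := ler_wpM2l (_ : 0 <= s - r) rk1; rewrite subr_ge0 => /(_ rs).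
  lra.
have cd : pgf m s - pgf m r @[m --> \oo] --> pgf_lim s - pgf_lim r.
  by apply: cvgB; exact: cvg_pgf.
apply/andP; split.
  rewrite -(cvg_lim _ cd)//; apply: limr_ge; first exact: cvgP cd.
  apply: nearW => m; rewrite subr_ge0.
  by apply: ler_node_sum => t; case/andP: (step (tree_runoff t)).
rewrite -(cvg_lim _ cd)//; apply: limr_le; first exact: cvgP cd.
  apply: nearW => m; rewrite lerBlDl.
have K0 : 0 <= (s - r) / (1 - s) by rewrite divr_ge0// subr_ge0// ltW.
apply: (@le_trans _ _ (pgf m r + (s - r) / (1 - s) * node_sum m (fun=> 1))).
  rewrite -tree_sumZ -[leRHS]tree_sumD; apply: ler_node_sum => t.
  by rewrite mulr1; case/andP: (step (tree_runoff t)).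
by rewrite lerD2l ler_piMr// node_sum1_le1.
Qed.

(** The mean is the slope of [pgf n] at 1, with an error controlled by the second moment, which is
    finite for fixed [n]. *)
Lemma le_mean_runoff n s : 0 <= s <= 1 ->
  pgf n 1 - pgf n s <= (1 - s) * mean_runoff n /\
  (1 - s) * mean_runoff n <= pgf n 1 - pgf n s
    + (1 - s) ^+ 2 * node_sum n (fun t => (tree_runoff t)%:R ^+ 2).
Proof.
move=> /andP[s0 s1].
have step k : 1 - s ^+ k <= (1 - s) * k%:R
    <= 1 - s ^+ k + (1 - s) ^+ 2 * k%:R ^+ 2.
  elim: k => [|k /andP[IH1 IH2]].
    by rewrite expr0 subrr mulr0 lexx /= expr0n /= mulr0 addr0.
  have k0 : 0 <= k%:R :> R by [].
  have sk1 : s ^+ k <= 1 by rewrite exprn_ile1.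
  rewrite exprS -natr1; apply/andP; split; first nra.
  have := ler_wpM2l s0 IH2.
  have : 0 <= (1 - s) ^+ 2 * k%:R by rewrite mulr_ge0// sqr_ge0.
  have : 0 <= (1 - s) ^+ 2 * ((1 - s) * k%:R ^+ 2).
    by rewrite !mulr_ge0 ?sqr_ge0// subr_ge0.
  have : 0 <= (1 - s) ^+ 2 by rewrite sqr_ge0.
  lra.
have dE : pgf n 1 - pgf n s = node_sum n (fun t => 1 - s ^+ tree_runoff t).
  rewrite pgf1 -mulN1r -tree_sumZ -[LHS]tree_sumD.
  by apply: eq_tree_sum => t; rewrite mulN1r.
rewrite dE -!tree_sumZ -[X in _ /\ _ <= X]tree_sumD.
by split; apply: ler_node_sum => t; case/andP: (step (tree_runoff t)).
Qed.

(** * The kernel equation and its lower branch *)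

Let A (s : R) := al * s ^+ 2 + (1 - al).
Let q (s : R) := 1 - al - al * s.
Let p := (1 - al) * offspring_pgf (pgf_lim 0).

(** The functional equation in u = 1 - G, since A - s = (1 - s) q. *)
Lemma kernel_equation s : 0 <= s <= 1 ->
  A s * c * (1 - pgf_lim s) ^+ 2 - (1 - s) * q s * (1 - pgf_lim s)
    + (1 - s) * (q s - p) = 0.
Proof.
by move=> /pgf_limE; rewrite /A /q -/p /offspring_pgf; lra.
Qed.

(** Completing the square; the right-hand side is D because q - p = al d - eps. *)
Lemma kernel_discriminant s : 0 <= s <= 1 ->
  (2 * A s * c * (1 - pgf_lim s) - (1 - s) * q s) ^+ 2 =
  (1 - s) * ((1 - s) * q s ^+ 2 - 4 * A s * c * (q s - p)).
Proof.
move=> /kernel_equation; set u := 1 - pgf_lim s => eu.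
transitivity ((1 - s) ^+ 2 * q s ^+ 2
  + 4 * A s * c * (A s * c * u ^+ 2 - (1 - s) * q s * u)); first by ring.
rewrite (_ : A s * c * u ^+ 2 - (1 - s) * q s * u = - ((1 - s) * (q s - p))).
  ring.
by apply/eqP; rewrite -subr_eq0 opprK eu.
Qed.

Let A_gt0 s : 0 < A s.
Proof.
have := mulr_ge0 (ltW al_gt0) (sqr_ge0 s); rewrite /A.
by move: al_lt1; lra.
Qed.

Let A_le1 s : 0 <= s <= 1 -> A s <= 1.
Proof.
move=> /andP[s0 s1].
have : al * s ^+ 2 <= al * 1 by rewrite ler_wpM2l ?(ltW al_gt0)// expr_le1.
by rewrite /A; lra.
Qed.

(* Otherwise the discriminant would be negative for s close to 1. *)
Lemma empty_prob_ge : 1 - 2 * al <= p.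
Proof.
apply/ler_addgt0Pl => e e0.
(* With x = q (1 - d), nonnegativity of the discriminant reads 4 A c (x - p) <= d x^2. If x > p,
   then A >= 1 - al and |x| <= 1 yield K (x - p) <= d <= K e. *)
pose K := 4 * (1 - al) * c.
have K0 : 0 < K by rewrite !mulr_gt0// subr_gt0.
pose d := Num.min 1 (K * e).
have d0 : 0 < d by rewrite lt_min ltr01 mulr_gt0.
have d1 : d <= 1 by rewrite ge_min lexx.
have de : d <= K * e by rewrite ge_min lexx orbT.
have s01 : 0 <= 1 - d <= 1 by rewrite subr_ge0 d1 gerBl ltW.
have := sqr_ge0
  (2 * A (1 - d) * c * (1 - pgf_lim (1 - d)) - (1 - (1 - d)) * q (1 - d)).
rewrite kernel_discriminant// subKr pmulr_rge0// subr_ge0.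
have -> : q (1 - d) = 1 - 2 * al + al * d by rewrite /q; ring.
set x := 1 - 2 * al + al * d => hx.
have ad : 0 <= al * d <= al.
  by rewrite mulr_ge0 ?(ltW d0) ?(ltW al_gt0)//= ler_piMr // ltW.
suff xe : x - p <= e by move: ad xe; rewrite /x; lra.
have [x0|x0] := leP (x - p) 0; first exact: le_trans x0 (ltW e0).
rewrite -(ler_pM2l K0); apply: le_trans de; apply: le_trans (_ : d * x ^+ 2 <= _).
  apply: le_trans hx; rewrite /K ler_wpM2r ?(ltW x0)// ler_wpM2r ?(ltW c_gt0)// ler_wpM2l//.
  by rewrite /A lerDr mulr_ge0 ?sqr_ge0 ?(ltW al_gt0).
have [x1 x2] : -1 <= x /\ x <= 1.
  by move: ad al_lt1; rewrite /x; lra.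
rewrite ler_piMr ?(ltW d0)//.
have : 0 <= (1 - x) * (1 + x) by rewrite mulr_ge0//; lra.
by rewrite -subr_sqr expr1n subr_ge0.
Qed.

(* The discriminant does not vanish on [0, 1), so by the intermediate value
   theorem the sign found at s = 0 persists. *)
Lemma kernel_minus_branch s : 0 < 1 - 2 * al -> 4 * c * al <= (1 - 2 * al) ^+ 2 ->
  0 <= s < 1 -> 2 * A s * c * (1 - pgf_lim s) < (1 - s) * q s.
Proof.
move=> al2 sub /andP[s0 s1].
pose psi r := 2 * A r * c * (1 - pgf_lim r) - (1 - r) * q r.
(* 4 A c (q - p) <= 4 A c al (1 - r) <= (1 - r) (1 - 2 al)^2 < (1 - r) q^2, by [empty_prob_ge], A <=
   1 and q > 1 - 2 al. *)
have psi_neq0 r : 0 <= r < 1 -> psi r != 0.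
  move=> /andP[r0 r1]; rewrite -sqrf_eq0 kernel_discriminant ?r0 ?ltW//.
  rewrite gt_eqF// mulr_gt0 ?subr_gt0//.
  have p_ge := empty_prob_ge.
  have A1 : A r <= 1 by rewrite A_le1// r0 ltW.
  have q2 : (1 - 2 * al) ^+ 2 < q r ^+ 2.
    have : 1 - 2 * al < q r.
      have : al * r < al * 1 by rewrite ltr_pM2l.
      by rewrite /q; lra.
    move=> q1; rewrite ltr_pXn2r ?nnegrE ?(ltW al2)//; lra.
  have Ac : 0 < A r * c by rewrite mulr_gt0.
  have : 4 * (A r * c) * (q r - p) <= 4 * (A r * c) * (al * (1 - r)).
    by rewrite ler_wpM2l//; rewrite /q; lra.
  have : (1 - r) * (4 * c * al * A r) <= (1 - r) * (4 * c * al * 1).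
    by rewrite !ler_wpM2l // ?subr_ge0 ?(ltW r1)// !mulr_ge0 ?(ltW c_gt0) ?(ltW al_gt0).
  have : (1 - r) * (4 * c * al) < (1 - r) * q r ^+ 2.
    by rewrite ltr_pM2l ?subr_gt0// (le_lt_trans sub).
  lra.
(* Here A = q = 1 - al, so psi 0 = (1 - al) (2 c u - 1) with c u <= 1/4. *)
have psi0 : psi 0 < 0.
  have g0 : 0 <= pgf_lim 0 by apply: pgf_lim_ge0; rewrite lexx ler01.
  rewrite /psi /A /q.
  have : (1 - al) * (c * (1 - pgf_lim 0)) <= (1 - al) * (4^-1 * 1).
    have g1 : pgf_lim 0 <= 1 by apply: pgf_lim_le1; rewrite lexx ler01.
    rewrite ler_wpM2l ?subr_ge0 ?(ltW al_lt1)// ler_pM// ?subr_ge0 ?(ltW c_gt0)//.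
    by rewrite gerBl.
  by move: al_lt1; lra.
rewrite -subr_lt0 -/(psi s) ltNge; apply/negP => psis.
have cpsi : {within `[0, s], continuous psi}.
  apply/subspace_continuousP => r /=; rewrite in_itv /= => /andP[r0 rs].
  have cid : t @[t --> within [set` `[0, s]] (nbhs r)] --> r.
    exact: cvg_within.
  have cG : pgf_lim t @[t --> within [set` `[0, s]] (nbhs r)] --> pgf_lim r.
    apply/cvgrPdist_le => e e0; rewrite near_withinE.
    have es : 0 < e * (1 - s) by rewrite mulr_gt0// subr_gt0.
    near=> t; rewrite /= in_itv /= => /andP[t0 ts].
    have rt : `|r - t| <= e * (1 - s).
      by near: t; exact: (@cvgr_dist_le _ _ _ _ _ id r).
    have lip a b : 0 <= a -> a <= b -> b <= s ->
        `|pgf_lim b - pgf_lim a| <= (b - a) / (1 - s).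
      move=> a0 ab bs; have b1 := le_lt_trans bs s1.
      have /andP[g0 g1] := pgf_lim_lipschitz a0 ab b1.
      rewrite ger0_norm//; apply: le_trans g1 _.
      by rewrite ler_wpM2l ?subr_ge0// lef_pV2 ?posrE ?subr_gt0// lerD2l lerN2.
    have [tr|rt'] := leP t r.
      apply: le_trans (lip _ _ t0 tr rs) _.
      by rewrite ler_pdivrMr ?subr_gt0// (le_trans (ler_norm _)).
    rewrite distrC; apply: le_trans (lip _ _ r0 (ltW rt') ts) _.
    by rewrite ler_pdivrMr ?subr_gt0// (le_trans (ler_norm _))// distrC.
  rewrite /psi /A /q; apply: cvgB; apply: cvgM.
  - apply: cvgMl; apply: cvgMr; apply: cvgD; last exact: cvg_cst.
    by apply: cvgMr; rewrite expr2; under eq_fun do rewrite expr2; exact: cvgM.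
  - by apply: cvgB => //; exact: cvg_cst.
  - by apply: cvgB => //; exact: cvg_cst.
  - by apply: cvgB; [exact: cvg_cst|apply: cvgMr].
have psi_sign : Num.min (psi 0) (psi s) <= 0 <= Num.max (psi 0) (psi s).
  by rewrite ge_min le_max (ltW psi0) psis orbT.
have [r] := IVT s0 cpsi psi_sign; rewrite in_itv /= => /andP[r0 rs] /eqP.
by apply/negP/psi_neq0; rewrite r0 (le_lt_trans rs).
Unshelve. all: by end_near. Qed.

(** * Upper bound for the mean *)

Section smaller_root.
Variable m : R.
Hypotheses (m_ge0 : 0 <= m) (m_le : 2 * c * m <= 1 - 2 * al)
  (m_root : c * m ^+ 2 - (1 - 2 * al) * m + al = 0).

(** Let Q be the quadratic of [kernel_equation] and d = 1 - s. Then Q(d m) <= 0 by [m_root],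
    [empty_prob_ge], A <= 1 and q >= 1 - 2 al. On the lower branch Q decreases up to u, so u > d m
    would give 0 = Q(u) < Q(d m). *)
Lemma pgf_lim_slope_le s : 0 <= s < 1 -> 1 - pgf_lim s <= (1 - s) * m.
Proof.
move=> /andP[s0 s1]; have s01 : 0 <= s <= 1 by rewrite s0 ltW.
have al2 : 0 < 1 - 2 * al.
  have h : 0 < (1 - 2 * al) * m.
    by have := mulr_ge0 (ltW c_gt0) (sqr_ge0 m); move: m_root al_gt0; lra.
  have m0 : 0 < m.
    by rewrite lt0r m_ge0 andbT; apply: contraTneq h => ->; rewrite mulr0 ltxx.
  by move: h; rewrite pmulr_lgt0.
have sub : 4 * c * al <= (1 - 2 * al) ^+ 2.
  rewrite -subr_ge0 (_ : _ - _ = (2 * c * m - (1 - 2 * al)) ^+ 2) ?sqr_ge0//.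
  rewrite -[RHS](subr0) -[X in _ = _ - X](mulr0 (4 * c)) -m_root; ring.
have s01' : 0 <= s < 1 by rewrite s0.
have := kernel_minus_branch al2 sub s01'.
have := kernel_equation s01; have := empty_prob_ge.
set u := 1 - pgf_lim s; set d := 1 - s => p_ge eu lu.
have d0 : 0 < d by rewrite subr_gt0.
rewrite leNgt; apply/negP => mu.
have Ac : 0 < A s * c by rewrite mulr_gt0.
have : d * (d * ((1 - A s) * (c * m ^+ 2) + (q s - (1 - 2 * al)) * m)) >= 0.
  rewrite !mulr_ge0 ?(ltW d0)// addr_ge0// mulr_ge0//.
  - by rewrite subr_ge0 A_le1.
  - by rewrite mulr_ge0 ?sqr_ge0 ?(ltW c_gt0).
  - by have := ler_wpM2l (ltW al_gt0) (ltW s1); rewrite /q; lra.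
(* This product is Q(d m) - Q(u); its second factor is positive because u + d m < 2 u. *)
have : 0 < (u - d * m) * (d * q s - A s * c * (u + d * m)).
  rewrite mulr_gt0 ?subr_gt0//; apply: le_lt_trans lu.
  have := ler_wpM2l (ltW Ac) (ltW mu); lra.
have : d * (q s - p) <= d * (al * d).
  by rewrite ler_pM2l//; move: p_ge; rewrite /q /d; lra.
move: eu; have : d ^+ 2 * (c * m ^+ 2 - (1 - 2 * al) * m + al) = 0.
  by rewrite m_root mulr0.
lra.
Qed.

(** With d = 1 - s, d times the mean is at most d m + d^2 K, where K depends on [n] only; divide by
    d and let d tend to 0. *)
Lemma mean_runoff_le n : mean_runoff n <= m.
Proof.
set K := node_sum n (fun t => (tree_runoff t)%:R ^+ 2).
have K0 : 0 <= K.
  by apply: (tree_sum_ge0 (p := fun=> node_law)) => // t; rewrite sqr_ge0.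
apply/ler_addgt0Pl => e e0.
pose d := Num.min 1 (e / (K + 1)).
have K1 : 0 < K + 1 by rewrite ltr_wpDl.
have d0 : 0 < d by rewrite lt_min ltr01 divr_gt0.
have d1 : d <= 1 by rewrite ge_min lexx.
have de : d * K <= e.
  apply: (@le_trans _ _ (e / (K + 1) * (K + 1))); last by rewrite divfK ?gt_eqF.
  by rewrite ler_pM ?(ltW d0)// ?ge_min ?lexx ?orbT// lerDl ler01.
have s01 : 0 <= 1 - d < 1 by rewrite subr_ge0 d1 gtrBl.
have s01' : 0 <= 1 - d <= 1 by case/andP: s01 => -> /ltW.
have [_] := le_mean_runoff n s01'; rewrite -/K.
have := pgf_le_lim n s01'; have := pgf_lim_slope_le s01.
rewrite subKr => h1 h2 h3.
rewrite -(ler_pM2l d0); apply: le_trans h3 _.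
have : d * (d * K) <= d * e by rewrite ler_pM2l.
by move: h1 h2; lra.
Qed.
End smaller_root.

(** * The quadratic equation for a finite mean *)

Lemma mean_runoff_ndecr : nondecreasing_seq mean_runoff.
Proof.
by apply/nondecreasing_seqP => n; apply: node_sum_leS => t; exact: ler0n.
Qed.

(** Along s = 1 - 1 / (k + 1) the ratio u / d tends to M; the kernel equation first forces eps = 0
    and then passes to the limit. *)
Lemma mean_runoff_root (M : R) : mean_runoff n @[n --> \oo] --> M ->
  c * M ^+ 2 - (1 - 2 * al) * M + al = 0.
Proof.
move=> cM.
have mean_leM n : mean_runoff n <= M.
  by rewrite -(cvg_lim _ cM)//; apply: nondecreasing_cvgn_le;
    [exact: mean_runoff_ndecr|exact: cvgP cM].
pose d (k : nat) : R := k.+1%:R^-1.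
have d_gt0 k : 0 < d k by rewrite invr_gt0 ltr0n.
have d_le1 k : d k <= 1 by rewrite invf_le1 ?ltr0n// ler1n.
have d_cvg : d k @[k --> \oo] --> 0 by exact: cvg_harmonic.
have sd k : 0 <= 1 - d k <= 1 by rewrite subr_ge0 d_le1 gerBl ltW.
pose v k := (1 - pgf_lim (1 - d k)) / d k.
have vE k : 1 - pgf_lim (1 - d k) = d k * v k.
  by rewrite mulrC divfK// gt_eqF.
have v_leM k : v k <= M.
  rewrite ler_pdivrMr// mulrC -[X in X - _]pgf_lim1.
  have c1 : pgf n 1 - pgf n (1 - d k) @[n --> \oo] --> pgf_lim 1 - pgf_lim (1 - d k).
    by apply: cvgB; apply: cvg_pgf; rewrite // ler01 lexx.
  rewrite -(cvg_lim _ c1)//; apply: limr_le; first exact: cvgP c1.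
  apply: nearW => n; have [+ _] := le_mean_runoff n (sd k); rewrite subKr.
  by move=> /le_trans; apply; rewrite ler_pM2l.
(* Squeeze between M and the mean at a fixed level [n] minus d K, where [n] brings the mean within e
   / 2 of M. *)
have v_cvg : v k @[k --> \oo] --> M.
  apply/cvgrPdist_le => e e0.
  have e20 : 0 < e / 2 by rewrite divr_gt0.
  have [n Mn] : exists n, M - mean_runoff n <= e / 2.
    move/cvgrPdist_le: cM => /(_ _ e20)[n _ /(_ n (leqnn n)) /= nM].
    by exists n; apply: le_trans nM; exact: ler_norm.
  pose K := node_sum n (fun t => (tree_runoff t)%:R ^+ 2).
  have K_cvg : d k * K @[k --> \oo] --> 0.
    by rewrite -(mul0r K); apply: cvgMl.
  near=> k.
  have kK : d k * K <= e / 2.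
    apply: le_trans (ler_norm _) _; rewrite -[d k * K]subr0 distrC.
    by near: k; move/cvgrPdist_le : K_cvg; apply.
  rewrite ger0_norm ?subr_ge0//.
  have [_] := le_mean_runoff n (sd k); rewrite subKr -/K => h.
  have := le_trans h (lerD (pgf_le_lim n (sd k)) (lexx _)).
  rewrite vE expr2 -mulrA -mulrDr ler_pM2l//; lra.
(* With u = d v and q - p = al d - eps, the kernel equation becomes d^2 f = d eps. *)
pose f k := A (1 - d k) * c * v k ^+ 2 - q (1 - d k) * v k + al.
have fE k : d k * f k = p - (1 - 2 * al).
  apply: (mulfI (lt0r_neq0 (d_gt0 k))).
  have := kernel_equation (sd k); rewrite vE subKr /f {2}/q => e.
  apply/eqP; rewrite -subr_eq0 -[X in _ == X]e; apply/eqP; ring.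
have f_cvg : f k @[k --> \oo] --> c * M ^+ 2 - (1 - 2 * al) * M + al.
  have dn1 : 1 - d k @[k --> \oo] --> (1 : R).
    by rewrite -[X in _ --> X]subr0; apply: cvgB => //; exact: cvg_cst.
  have sq (g : nat -> R) (l : R) : g k @[k --> \oo] --> l -> g k ^+ 2 @[k --> \oo] --> l ^+ 2.
    by move=> gl; rewrite expr2; under eq_fun do rewrite expr2; exact: cvgM.
  have A_cvg : A (1 - d k) @[k --> \oo] --> (1 : R).
    rewrite [X in _ --> X](_ : 1 = al * 1 ^+ 2 + (1 - al)); last by ring.
    by apply: cvgD; [apply: cvgMr; exact: sq|exact: cvg_cst].
  have q_cvg : q (1 - d k) @[k --> \oo] --> 1 - 2 * al.
    rewrite (_ : 1 - 2 * al = 1 - al - al * 1); last by ring.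
    by apply: cvgB; [exact: cvg_cst|apply: cvgMr].
  apply: cvgD; last exact: cvg_cst.
  rewrite -[X in X * M ^+ 2]mul1r.
  by apply: cvgB; apply: cvgM => //; [apply: cvgMl|exact: sq].
have p0 : p - (1 - 2 * al) = 0.
  have c1 : d k * f k @[k --> \oo] --> 0 * (c * M ^+ 2 - (1 - 2 * al) * M + al).
    exact: cvgM.
  rewrite mul0r (eq_fun fE) in c1.
  by apply: (cvg_unique _ _ c1) => //; exact: cvg_cst.
have f0 k : f k = 0.
  by apply: (mulfI (lt0r_neq0 (d_gt0 k))); rewrite fE mulr0.
rewrite (eq_fun f0) in f_cvg.
by apply: (cvg_unique _ f_cvg) => //; exact: cvg_cst.
Unshelve. all: by end_near. Qed.
End generating_function.

(** * The expected root runoff as a sum over trees *)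

(* The root runoff is only known to coincide almost everywhere with a measurable
   function, so it has to be compared with simple functions directly. *)
Section integral_without_measurability.
Import HBNNSimple.
Local Open Scope ereal_scope.
Context d (T : measurableType d) (R : realType).
Variable mu : {measure set T -> \bar R}.
Implicit Types f g : T -> \bar R.

(** The integral is a supremum over simple functions, and those below [f] are below [g]. *)
Lemma ge0_le_integral_nonmeasurable f g : (forall x, 0 <= f x) ->
  (forall x, f x <= g x) -> \int[mu]_x f x <= \int[mu]_x g x.
Proof.
move=> f0 fg; have g0 x : 0 <= g x := le_trans (f0 x) (fg x).
rewrite !ge0_integralTE//; apply: ereal_sup_le => _ /= [h hf <-].
by exists h => // x; exact: le_trans (hf x) (fg x).
Qed.

Lemma ae_ge0_le_integral_nonmeasurable f g : (forall x, 0 <= f x) ->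
  (forall x, 0 <= g x) -> measurable_fun setT g ->
  {ae mu, forall x, f x <= g x} -> \int[mu]_x f x <= \int[mu]_x g x.
Proof.
move=> f0 g0 mg [N [mN muN fgN]].
rewrite ge0_integralTE//; apply: ge_ereal_sup => _ /= [h hf <-].
have -> : sintegral mu h = \int[mu]_x (h x)%:E.
  by rewrite integral_nnsfun// patch_setT.
apply: ae_ge0_le_integral => //.
- by move=> x _; rewrite lee_fin.
- exact/measurable_EFinP.
- exists N; split=> //; apply: subset_trans fgN; apply: subsetC => x fg _.
  exact: le_trans (hf x) fg.
Qed.
End integral_without_measurability.

(** * The law of the marked family tree and the expected runoff *)

Section model.
Context {d : measure_display} {T : measurableType d} {R : realType}.
Variables (P : probability T R) (beta alpha : R).
Hypotheses (beta_gt0 : 0 < beta) (beta_le : beta <= 2^-1)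
    (alpha_gt0 : 0 < alpha) (alpha_lt1 : alpha < 1).
Variables (Z : seq nat -> {RV P >-> nat}) (X : seq nat -> {RV P >-> R}).
Hypothesis (model : runoff_model beta alpha Z X).

Let c := beta * (1 - beta).

Definition node_event (e : seq nat * bool * nat) : set T :=
  [set w | Z e.1.1 w = e.2] `&` [set w | X e.1.1 w = (-1) ^+ ~~ e.1.2].

(** Leaves are required to have no children, so this is the event that the marked family tree is
    exactly [t]. *)
Definition tree_event (t : btree) : set T :=
  \bigcap_(e in [set` nodes [::] t]) node_event e.

Lemma mutually_independent_seq (I : choiceType) (F : I -> set_system T)
    (s : seq I) (A : I -> set T) :
  mutually_independent P F -> uniq s -> (forall i, i \in s -> F i (A i)) ->
  P (\bigcap_(i in [set` s]) A i) = (\prod_(i <- s) P (A i))%E.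
Proof.
move=> Find us sF; have := Find [fset i | i in s]%fset A.
rewrite (perm_big s) /=; last first.
  by apply: uniq_perm => // i; rewrite !inE.
move=> <- => [|i]; last by rewrite !inE; exact: sF.
by congr (P _); apply: eq_bigcapl; split => i; rewrite /= !inE.
Qed.

Let offspring_prob v k : (k <= 2)%N ->
  P [set w | Z v w = k] = (if k == 1%N then 1 - 2 * c else c)%:E.
Proof.
case: k => [|[|[|//]]] _ /=.
- exact: offspring0 model v.
- by rewrite (offspring1 model v) /c; congr (_%:E); ring.
- exact: offspring2 model v.
Qed.

Let contribution_prob v (b : bool) :
  P [set w | X v w = (-1) ^+ ~~ b] = (if b then alpha else 1 - alpha)%:E.
Proof.
case: b => /=.
  by rewrite expr0; exact: contribution1 model v.
by rewrite expr1; exact: contributionN1 model v.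
Qed.

Lemma measurable_node_event e : measurable (node_event e).
Proof.
apply: measurableI.
- rewrite -[X in measurable X]setTI.
  exact: (measurable_funP (Z e.1.1) measurableT [set e.2]).
- rewrite -[X in measurable X]setTI.
  exact: (measurable_funP (X e.1.1) measurableT [set (-1) ^+ ~~ e.1.2]).
Qed.

Lemma measurable_tree_event t : measurable (tree_event t).
Proof.
by apply: fin_bigcap_measurable => // e _; exact: measurable_node_event.
Qed.

Lemma prob_tree_event t :
  P (tree_event t) = (tree_weight (fun=> node_law c alpha) [::] t)%:E.
Proof.
set L := nodes [::] t; pose vs := [seq e.1.1 | e <- L].
(* Independence asks for events indexed by the variables rather than by the nodes; as labels are
   distinct, each intersection is over the one node labelled [v]. *)
pose B (i : seq nat + seq nat) : set T := match i with
  | inl v => \bigcap_(e in [set` [seq e <- L | e.1.1 == v]]) [set w | Z v w = e.2]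
  | inr v => \bigcap_(e in [set` [seq e <- L | e.1.1 == v]])
      [set w | X v w = (-1) ^+ ~~ e.1.2]
  end.
have L1 e : e \in L -> [set` [seq e' <- L | e'.1.1 == e.1.1]] = [set e].
  move=> eL; apply/seteqP; split => e' /=; rewrite mem_filter.
    move=> /andP[/eqP ee' e'L].
    exact: (uniq_map_inj (uniq_nodes [::] t) e'L eL ee').
  by move=> ->; rewrite eqxx.
have BZ e : e \in L -> B (inl e.1.1) = [set w | Z e.1.1 w = e.2].
  by move=> eL; rewrite /B L1// bigcap_set1.
have BX e : e \in L -> B (inr e.1.1) = [set w | X e.1.1 w = (-1) ^+ ~~ e.1.2].
  by move=> eL; rewrite /B L1// bigcap_set1.
pose s : seq (seq nat + seq nat) := map inl vs ++ map inr vs.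
have us : uniq s.
  rewrite cat_uniq (map_inj_uniq inl_inj) (map_inj_uniq inr_inj) !uniq_nodes.
  by rewrite andbT; apply/hasPn => _ /mapP[v _ ->]; apply/mapP => -[].
have -> : tree_event t = \bigcap_(i in [set` s]) B i.
  apply/seteqP; split => w /= h.
    move=> i /=; rewrite mem_cat => /orP[] /mapP[_ /mapP[e eL ->] ->].
    - by rewrite BZ//; case: (h e eL).
    - by rewrite BX//; case: (h e eL).
  move=> e /= eL; split.
  - rewrite -BZ//; apply: h; rewrite /= mem_cat; apply/orP; left.
    by apply: map_f; exact: (map_f (fun e => e.1.1)).
  - rewrite -BX//; apply: h; rewrite /= mem_cat; apply/orP; right.
    by apply: map_f; exact: (map_f (fun e => e.1.1)).
rewrite (mutually_independent_seq (model_indep model))//; last first.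
  move=> i; rewrite mem_cat => /orP[] /mapP[_ /mapP[e eL ->] ->].
  - rewrite BZ// /= /sigma_rv /preimage_set_system.
    by exists [set e.2] => //; rewrite setTI.
  - rewrite BX// /= /sigma_rv /preimage_set_system.
    by exists [set (-1) ^+ ~~ e.1.2] => //; rewrite setTI.
rewrite big_cat !big_map /= -big_split /= /tree_weight -prodEFin.
rewrite big_seq [RHS]big_seq; apply: eq_bigr => e eL.
rewrite L1// !bigcap_set1 offspring_prob ?(in_nodes_arity eL)// contribution_prob.
by rewrite -EFinM mulrC.
Qed.

Definition node_indicator (w : T) (v : seq nat) (b : bool) (k : nat) : R :=
  ((Z v w == k) && (X v w == (-1) ^+ ~~ b))%:R.

Definition indicator_sum n (a : btree -> R) (w : T) : R :=
  tree_sum (node_indicator w) [::] n a.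

Lemma tree_weight_indicator w t :
  tree_weight (node_indicator w) [::] t = \1_(tree_event t) w.
Proof.
rewrite /tree_weight (nat_eqb_prod _ _
  (fun e => (Z e.1.1 w == e.2) && (X e.1.1 w == (-1) ^+ ~~ e.1.2))).
rewrite indicE; congr (_%:R); congr nat_of_bool; apply/allP/idP => [h|].
  by rewrite inE => e /= eL; have /andP[/eqP ? /eqP ?] := h e eL; split.
by rewrite inE => h e eL; have [/= -> ->] := h e eL; rewrite !eqxx.
Qed.

Let node_indicator_ge0 w v b k : 0 <= node_indicator w v b k.
Proof. exact: ler0n. Qed.

Lemma indicator_sumE n a w :
  indicator_sum n a w = \sum_(t <- trees n) a t * \1_(tree_event t) w.
Proof. by apply: eq_bigr => t _; rewrite tree_weight_indicator mulrC. Qed.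

Lemma measurable_indicator_sum n a : measurable_fun setT (indicator_sum n a).
Proof.
rewrite (_ : indicator_sum n a = fun w => \sum_(t <- trees n) a t * \1_(tree_event t) w).
  apply: measurable_sum => t; apply: measurable_funM => //.
  exact/measurable_indicP/measurable_tree_event.
by apply/funext => w; exact: indicator_sumE.
Qed.

Lemma indicator_sum_ge0 n a w : (forall t, 0 <= a t) -> 0 <= indicator_sum n a w.
Proof. exact: tree_sum_ge0. Qed.

Lemma indicator_sum_ndecr a w : (forall t, 0 <= a t) ->
  nondecreasing_seq (fun n => indicator_sum n a w).
Proof.
by move=> a0; apply/nondecreasing_seqP => n; apply: tree_sum_leS.
Qed.

Lemma indicator_sum1_le1 n w : indicator_sum n (fun=> 1) w <= 1.
Proof.
apply: tree_sum1_le1 => // v; rewrite big_cons big_seq1 /node_indicator /= expr0 expr1.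
have [->|_] := eqVneq (X v w) 1.
  have -> : (1 == -1 :> R) = false by apply/eqP; lra.
  by case: (Z v w) => [|[|[|k]]] /=; lra.
by case: (X v w == -1); case: (Z v w) => [|[|[|k]]] /=; lra.
Qed.

Lemma integral_indicator_sum n a : (forall t, 0 <= a t) ->
  (\int[P]_w (indicator_sum n a w)%:E)%E = (node_sum c alpha n a)%:E.
Proof.
move=> a0; under eq_integral do rewrite indicator_sumE -sumEFin.
rewrite ge0_integral_sum//; last 2 first.
- move=> t; apply/measurable_EFinP; apply: measurable_funM => //.
  exact/measurable_indicP/measurable_tree_event.
- by move=> t w _; rewrite lee_fin mulr_ge0.
rewrite /node_sum /tree_sum -sumEFin; apply: eq_bigr => t _.
under eq_integral do rewrite EFinM.
have mt := measurable_tree_event t.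
rewrite ge0_integralZl_EFin//; last first.
  exact/measurable_EFinP/measurable_indicP.
rewrite integral_indic// setIT mulrC EFinM; congr (_ * _)%E.
exact: prob_tree_event.
Qed.

(** Wherever an indicator is 1, [runoff_at_tree] identifies [tree_runoff t] with the root runoff. *)
Lemma indicator_sum_runoff n w :
  indicator_sum n (fun t => (tree_runoff t)%:R) w =
  root_runoff Z X w * indicator_sum n (fun=> 1) w.
Proof.
rewrite !indicator_sumE mulr_sumr; apply: eq_bigr => t _; rewrite mul1r indicE.
case: (boolP (w \in _)) => [|_]; last by rewrite !mulr0.
rewrite inE !mulr1 => wt; rewrite /root_runoff.
by apply/esym/runoff_at_runoff/runoff_at_tree => e /wt[].
Qed.

Lemma root_runoff_ge0 w : 0 <= root_runoff Z X w.
Proof.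
rewrite /root_runoff /runoff; case: xgetP => [x _|//] h; rewrite -/(_ <= x).
by case: h => u k _; rewrite le_max lexx orbT.
Qed.

Let c_gt0 : 0 < c.
Proof. by rewrite mulr_gt0// subr_gt0; move: beta_le; lra. Qed.

Let c_le : c <= 4^-1.
Proof. by have := sqr_ge0 (beta - 2^-1); rewrite /c; lra. Qed.

(** Monotone convergence for [h n], which is the root runoff times [e n]. Since [e n <= 1], the
    limit H is at most the root runoff; since [e n] increases to 1 almost surely, the two agree
    almost everywhere. *)
Lemma cvg_mean_runoff :
  (mean_runoff c alpha n)%:E @[n --> \oo] --> ('E_P[root_runoff Z X])%E.
Proof.
pose W t : R := (tree_runoff t)%:R.
have W0 t : 0 <= W t by exact: ler0n.
have one0 (t : btree) : 0 <= 1 :> R by exact: ler01.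
pose h n w := (indicator_sum n W w)%:E.
pose e n w := (indicator_sum n (fun=> 1) w)%:E.
have mh n : measurable_fun setT (h n).
  exact/measurable_EFinP/measurable_indicator_sum.
have me n : measurable_fun setT (e n).
  exact/measurable_EFinP/measurable_indicator_sum.
have h0 n w : (0 <= h n w)%E by rewrite lee_fin indicator_sum_ge0.
have e0 n w : (0 <= e n w)%E by rewrite lee_fin indicator_sum_ge0.
have nh w : nondecreasing_seq (h ^~ w).
  by move=> m n mn; rewrite lee_fin indicator_sum_ndecr.
have ne w : nondecreasing_seq (e ^~ w).
  by move=> m n mn; rewrite lee_fin indicator_sum_ndecr.
pose H w := limn (h ^~ w); pose E w := limn (e ^~ w).
have cH w : h n w @[n --> \oo] --> H w := ereal_nondecreasing_is_cvgn (nh w).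
have cE w : e n w @[n --> \oo] --> E w := ereal_nondecreasing_is_cvgn (ne w).
have mH : measurable_fun setT H by apply: emeasurable_fun_cvg mh _ => w _.
have mE : measurable_fun setT E by apply: emeasurable_fun_cvg me _ => w _.
have H0 w : (0 <= H w)%E by apply: lime_ge; [exact: cvgP (cH w)|exact: nearW].
have E0 w : (0 <= E w)%E by apply: lime_ge; [exact: cvgP (cE w)|exact: nearW].
have E1 w : (E w <= 1)%E.
  apply: lime_le; first exact: cvgP (cE w).
  by apply: nearW => n; rewrite lee_fin indicator_sum1_le1.
have intH : (mean_runoff c alpha n)%:E @[n --> \oo] --> (\int[P]_w H w)%E.
  rewrite (_ : (fun n => _) = fun n => (\int[P]_w h n w)%E); last first.
    by apply/funext => n; rewrite integral_indicator_sum.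
  exact: cvg_monotone_convergence.
have intE : (\int[P]_w E w = 1)%E.
  rewrite monotone_convergence//; apply/cvg_lim => //.
  rewrite (_ : (fun n => _) = fun n => (pgf c alpha n 1)%:E); last first.
    by apply/funext => n; rewrite integral_indicator_sum// pgf1.
  apply/fine_cvgP; split; first exact: nearW.
  rewrite -[X in _ --> X](pgf_lim1 c_gt0 c_le alpha_gt0 alpha_lt1).
  by apply: cvg_pgf => //; rewrite ler01 lexx.
(* A function bounded by 1 with integral 1 under a probability is 1 almost everywhere. *)
have aeE : {ae P, forall w, E w = 1%E}.
  have fE w : E w \is a fin_num.
    by rewrite ge0_fin_numE// (le_lt_trans (E1 w)) ?ltry.
  have D0 w : (0 <= 1 - E w)%E by rewrite sube_ge0 ?fE ?E1.
  have mD : measurable_fun setT (fun w => 1 - E w)%E.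
    by apply: emeasurable_funB.
  have : (\int[P]_w (E w + (1 - E w)) = 1)%E.
    rewrite (eq_integral (cst 1%E)).
      by rewrite integral_cst// mul1e; exact: probability_setT.
    by move=> w _; rewrite addeC subeK.
  rewrite ge0_integralD// intE => int1.
  have int0 : (\int[P]_w (1 - E w) = 0)%E.
    have f1 : 1%E \is a @fin_num R by [].
    by rewrite -[LHS](addeK _ f1) (addeC _ 1%E) int1 subee.
  have : (\int[P]_w `|1 - E w| = 0)%E.
    by rewrite -[RHS]int0; apply: eq_integral => w _; rewrite gee0_abs.
  move=> /(ae_eq_integral_abs P measurableT mD); apply: filterS => w /(_ I) /eqP.
  by rewrite sube_eq ?fE// add0e => /eqP.
suff -> : ('E_P[root_runoff Z X] = \int[P]_w H w)%E by [].
rewrite unlock; apply/eqP; rewrite eq_le; apply/andP; split.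
- apply: ae_ge0_le_integral_nonmeasurable => //.
    by move=> w; rewrite lee_fin root_runoff_ge0.
  apply: filterS aeE => w Ew.
  have : h n w @[n --> \oo] --> ((root_runoff Z X w)%:E * E w)%E.
    rewrite (_ : (fun n => _) = fun n => ((root_runoff Z X w)%:E * e n w)%E).
      exact: cvgeZl.
    by apply/funext => n; rewrite /h indicator_sum_runoff EFinM.
  by rewrite Ew mule1 => /cvg_lim <-.
- apply: ge0_le_integral_nonmeasurable => // w.
  apply: lime_le; first exact: cvgP (cH w).
  apply: nearW => n; rewrite lee_fin indicator_sum_runoff ler_piMr//.
    exact: root_runoff_ge0.
  exact: indicator_sum1_le1.
Qed.
End model.

(** * Solving the quadratic equation for the mean *)

Theorem proposition1 (R : realType) (d : measure_display)
    (T : measurableType d) (P : probability T R) (beta alpha : R)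
    (beta_gt0 : 0 < beta) (beta_le : beta <= 2^-1)
    (alpha_gt0 : 0 < alpha) (alpha_lt1 : alpha < 1)
    (Z : seq nat -> {RV P >-> nat}) (X : seq nat -> {RV P >-> R})
    (model : runoff_model beta alpha Z X) :
  (alpha <= alpha_c beta ->
     ('E_P[root_runoff Z X])%E =
       ((2 * beta * (1 - beta))^-1 *
        (1 - 2 * alpha
         - Num.sqrt (1 - 4 * alpha * (1 - alpha + beta * (1 - beta)))))%:E) /\
  (alpha_c beta < alpha -> ('E_P[root_runoff Z X])%E = +oo%E).
Proof.
have := cvg_mean_runoff beta_gt0 beta_le alpha_gt0 alpha_lt1 model.
have c_gt0 : 0 < beta * (1 - beta).
  by rewrite mulr_gt0// subr_gt0; move: beta_le; lra.
have c_le : beta * (1 - beta) <= 4^-1.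
  by have := sqr_ge0 (beta - 2^-1); lra.
rewrite /alpha_c -(mulrA 2).
move: (beta * (1 - beta)) c_gt0 c_le => c c_gt0 c_le cvgE.
(* The condition alpha <= alpha_c says that 1 + c - 2 alpha is at least the square root of c (2 +
   c), which makes this discriminant nonnegative. *)
have DE : 1 - 4 * alpha * (1 - alpha + c) =
    (1 + c - 2 * alpha) ^+ 2 - c * (2 + c) by ring.
have rootE (M : R) : c * M ^+ 2 - (1 - 2 * alpha) * M + alpha = 0 ->
    1 - 4 * alpha * (1 - alpha + c) = (1 - 2 * alpha - 2 * c * M) ^+ 2.
  move=> M0; rewrite -[LHS]addr0 -[X in _ + X](mulr0 (4 * c)) -M0; ring.
have root_cvg (M : R) : mean_runoff c alpha n @[n --> \oo] --> M ->
  c * M ^+ 2 - (1 - 2 * alpha) * M + alpha = 0 by exact: mean_runoff_root.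
split=> [sub|sup].
- have sqrt_le : Num.sqrt (c * (2 + c)) <= 1 + c - 2 * alpha by lra.
  have cc_gt0 : 0 < c * (2 + c) by rewrite mulr_gt0// addr_gt0.
  set D := 1 - 4 * alpha * (1 - alpha + c).
  (* Uses c^2 < c (2 + c). *)
  have al2 : 0 < 1 - 2 * alpha.
    suff : c < Num.sqrt (c * (2 + c)) by lra.
    rewrite -[ltLHS](ger0_norm (ltW c_gt0)) -sqrtr_sqr ltr_sqrt// expr2.
    by rewrite ltr_pM2l// ltrDr.
  have D_ge0 : 0 <= D.
    rewrite /D DE subr_ge0 -(sqr_sqrtr (ltW cc_gt0)) lerXn2r ?nnegrE//.
    exact: le_trans sqrt_le.
  set m := (2 * c)^-1 * (1 - 2 * alpha - Num.sqrt D).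
  have cm : 2 * c * m = 1 - 2 * alpha - Num.sqrt D.
    by rewrite /m mulVKf// gt_eqF// mulr_gt0.
  have D_le : Num.sqrt D <= 1 - 2 * alpha.
    rewrite -[leRHS](ger0_norm (ltW al2)) -sqrtr_sqr ler_wsqrtr//.
    have := mulr_gt0 alpha_gt0 c_gt0; rewrite /D; lra.
  have m_ge0 : 0 <= m.
    by rewrite mulr_ge0 ?invr_ge0 ?subr_ge0// mulr_ge0// ltW.
  have m_le : 2 * c * m <= 1 - 2 * alpha by rewrite cm gerBl sqrtr_ge0.
  have m_root : c * m ^+ 2 - (1 - 2 * alpha) * m + alpha = 0.
    apply: (mulfI (lt0r_neq0 c_gt0)); rewrite mulr0.
    have : (1 - 2 * alpha - 2 * c * m) ^+ 2 = D by rewrite cm subKr sqr_sqrtr.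
    by rewrite /D; lra.
  have mean_le n : mean_runoff c alpha n <= m by exact: mean_runoff_le.
  have [M cM] : exists M : R, mean_runoff c alpha n @[n --> \oo] --> M.
    apply/cvg_ex/nondecreasing_is_cvgn; first exact: mean_runoff_ndecr.
    by exists m => _ [n _ <-].
  have Mm : M <= m.
    rewrite -(cvg_lim _ cM)//; apply: limr_le; first exact: cvgP cM.
    exact: nearW.
  have cMcm : c * M <= c * m by rewrite ler_pM2l.
  (* As M <= m, the number 1 - 2 alpha - 2 c M is nonnegative, hence equal to the square root of
     D. *)
  have <- : M = m.
    have c2_neq0 : 2 * c != 0 by rewrite mulf_neq0 ?pnatr_eq0// gt_eqF.
    apply: (mulfI c2_neq0); rewrite cm /D (rootE _ (root_cvg _ cM)) sqrtr_sqr ger0_norm; lra.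
  apply: cvg_unique cvgE _ => //.
  apply/fine_cvgP; split; [exact: nearW|exact: cM].
(* A finite mean M would be a nonnegative root, so that 1 - 2 alpha > 0 and the discriminant is
   nonnegative; the square root of c (2 + c) would then be at most 1 + c - 2 alpha, against alpha >
   alpha_c. *)
- have [//|Eoo] := eqVneq ('E_P[root_runoff Z X])%E +oo%E; exfalso.
  have E_ge0 : (0 <= 'E_P[root_runoff Z X])%E.
    by rewrite unlock integral_ge0// => w _; rewrite lee_fin root_runoff_ge0.
  have Efin : ('E_P[root_runoff Z X])%E \is a fin_num.
    by rewrite ge0_fin_numE// ltey.
  move: cvgE; rewrite -(fineK Efin) => /fine_cvgP[_ cM].
  set M := fine _ in cM; have M0 := root_cvg _ cM.
  have M_ge0 : 0 <= M by exact: fine_ge0.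
  have al2 : 0 < 1 - 2 * alpha.
    have h : 0 < (1 - 2 * alpha) * M.
      by have := mulr_ge0 (ltW c_gt0) (sqr_ge0 M); lra.
    have M_gt0 : 0 < M.
      by rewrite lt0r M_ge0 andbT; apply: contraTneq h => ->; rewrite mulr0 ltxx.
    by move: h; rewrite pmulr_lgt0.
  have : Num.sqrt (c * (2 + c)) <= 1 + c - 2 * alpha.
    rewrite -[leRHS]ger0_norm; last by lra.
    by rewrite -sqrtr_sqr ler_wsqrtr// -subr_ge0 -DE (rootE _ M0) sqr_ge0.
  by move: sup; lra.
Qed.
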